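(* Let $\underline{p}=(p_1,\dots,p_m)$ be a tuple of polynomials in $\mathbb{R}[\underline{t}]=\mathbb{R}[t_1,\dots,t_n]$, and suppose that the basic closed set $S=\mathscr{S}(\underline{p})=\{x\in\mathbb{R}^n \mid p_1(x)\geq 0,\dots,p_m(x)\geq 0\}$ is convex and has non-empty interior. Suppose that there exists $d\geq 1$ such that the $d$-th Lasserre relaxation of $S$ with respect to $\underline{p}$ is exact, i.e. $S(\underline{p})_d=S$. Then all faces of $S$ are exposed.
   Context: Let $\mathbb{R}[\underline{t}]_d$ be the vector space of real polynomials in $t_1,\dots,t_n$ of degree at most $d$, let $\mathbb{R}[\underline{t}]_d^\vee$ be its algebraic dual, and let $\sum\mathbb{R}[\underline{t}]^2$ be the set of finite sums of squares of polynomials in $\mathbb{R}[\underline{t}]$. For $\underline{p}=(p_1,\dots,p_m)$ set $p_0=1$ and $$\mathrm{QM}(\underline{p})_d=\Bigl\{\sum_{i=0}^m\sigma_i p_i \;\Big|\; \sigma_i\in\sum\mathbb{R}[\underline{t}]^2,\ \sigma_i p_i\in\mathbb{R}[\underline{t}]_d \text{ for all } i\Bigr\},$$ $$\mathscr{L}(\underline{p})_d=\bigl\{L\in\mathbb{R}[\underline{t}]_d^\vee \mid L\geq 0 \text{ on } \mathrm{QM}(\underline{p})_d,\ L(1)=1\bigr\}.$$ The $d$-th Lasserre relaxation (of $\mathrm{conv}(\mathscr{S}(\underline{p}))$ with respect to $\underline{p}$) is the set $S(\underline{p})_d=\{(L(t_1),\dots,L(t_n)) \mid L\in\mathscr{L}(\underline{p})_d\}\subseteq\mathbb{R}^n$.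 Let $S$ be a closed convex subset of $\mathbb{R}^n$ with non-empty interior. A supporting hyperplane of $S$ is an affine hyperplane $H\subseteq\mathbb{R}^n$ such that $S\cap H\neq\emptyset$ and $S\setminus H$ is connected (equivalently, $H$ is the zero set of a polynomial $\ell\neq 0$ of degree at most $1$ with $\ell\geq 0$ on $S$ and $\{\ell=0\}\cap S\neq\emptyset$). A face of $S$ is a non-empty convex subset $F\subseteq S$ such that for all $x,y\in S$ and $\lambda\in(0,1)$, if $\lambda x+(1-\lambda)y\in F$ then $x,y\in F$. A face $F$ of $S$ is exposed if either $F=S$ or there is a supporting hyperplane $H$ of $S$ with $H\cap S=F$. *)

(* Defs.v *)
From HB Require Import structures.
From mathcomp Require Import all_boot all_order all_algebra.
(* mpoly has to be loaded before the analysis files: in the other order their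
   notations clash. *)
From mathcomp Require Import mpoly.
From mathcomp Require Import classical_sets reals topology normedtype convex.

Set Implicit Arguments.
Unset Strict Implicit.
Unset Printing Implicit Defensive.

Import Order.TTheory GRing.Theory Num.Theory.
Import numFieldNormedType.Exports.

Local Open Scope classical_set_scope.
Local Open Scope ring_scope.

Section TruncatedPolynomials.
Context (n : nat) (R : comNzRingType) (d : nat).

(* [msize] is the total degree plus one, and 0 for the zero polynomial. *)
Definition polydeg := [qualify a q : {mpoly R[n]} | (msize q <= d.+1)%N].

Fact polydeg_submod_closed : submod_closed polydeg.
Proof.
split=> [|c p q]; rewrite !qualifE/= ?msize0// => dp dq.
apply: leq_trans (msizeD_le _ _) _.
by rewrite geq_max dq andbT; apply: leq_trans (msizeZ_le _ _) dp.
Qed.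

HB.instance Definition _ :=
  GRing.isSubmodClosed.Build R {mpoly R[n]} (has_quality 1 polydeg)
    polydeg_submod_closed.

Record mpolyd := MPolyd { mpoly_of_mpolyd :> {mpoly R[n]};
                          _ : mpoly_of_mpolyd \is a polydeg }.

HB.instance Definition _ := [isSub for mpoly_of_mpolyd].
HB.instance Definition _ := [Choice of mpolyd by <:].
HB.instance Definition _ := [SubChoice_isSubLmodule of mpolyd by <:].

(* [inmpolyd q] is [q] seen in R[t]_d; it is the junk value 0 if deg q > d. *)
Definition inmpolyd (q : {mpoly R[n]}) : mpolyd := insubd (0 : mpolyd) q.

Lemma inmpolydK (q : {mpoly R[n]}) :
  q \is a polydeg -> inmpolyd q = q :> {mpoly R[n]}.
Proof. by move=> dq; rewrite /inmpolyd; exact: (insubdK (0 : mpolyd) dq). Qed.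

End TruncatedPolynomials.

Arguments polydeg {n R} d.
Arguments inmpolyd {n R} d q.

Lemma polydeg1 (n : nat) (R : comNzRingType) (d : nat) :
  (1 : {mpoly R[n]}) \is a polydeg d.
Proof. by rewrite qualifE/= msize1. Qed.

Lemma polydegX (n : nat) (R : comNzRingType) (d : nat) (i : 'I_n) :
  (0 < d)%N -> ('X_i : {mpoly R[n]}) \is a polydeg d.
Proof. by rewrite qualifE/= msizeX mdeg1. Qed.

Section Lasserre.
Context (R : realType) (n m : nat).
Implicit Types (p : m.-tuple {mpoly R[n]}) (d : nat).

Definition basic_closed p : set 'rV[R]_n :=
  [set x | forall i : 'I_m, 0 <= (tnth p i).@[fun j => x ord0 j]].

Definition sum_of_squares (s : {mpoly R[n]}) : Prop :=
  exists qs : seq {mpoly R[n]}, s = \sum_(q <- qs) q ^+ 2.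

(* [1 :: p] puts the convention p_0 = 1 at index 0. *)
Definition quadratic_module p d : set (mpolyd n R d) :=
  [set f | exists sigma : 'I_m.+1 -> {mpoly R[n]},
    [/\ forall i, sum_of_squares (sigma i),
        forall i, sigma i * tnth [tuple of 1 :: p] i \is a polydeg d &
        (f : {mpoly R[n]}) =
          \sum_(i < m.+1) sigma i * tnth [tuple of 1 :: p] i]].

Arguments quadratic_module p d _ : clear implicits.

Definition lasserre_functionals p d : set {scalar mpolyd n R d} :=
  [set L | (forall f, quadratic_module p d f -> 0 <= L f) /\
           L (inmpolyd d 1) = 1].

Arguments lasserre_functionals p d _ : clear implicits.

(* For d = 0 the coordinate functions are not in R[t]_d and this is junk. *)
Definition lasserre_relaxation p d : set 'rV[R]_n :=
  [set \row_(i < n) (L : {scalar mpolyd n R d}) (inmpolyd d 'X_i)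
    | L in lasserre_functionals p d].

End Lasserre.

Arguments quadratic_module {R n m} p d _.
Arguments lasserre_functionals {R n m} p d _.

Section Faces.
Context (R : realType) (n : nat).
Implicit Types S F H : set 'rV[R]_n.

Definition affine_hyperplane H : Prop :=
  exists (a : 'rV[R]_n) (b : R),
    a != 0 /\ H = [set x | \sum_(i < n) a ord0 i * x ord0 i = b].

Definition supporting_hyperplane S H : Prop :=
  [/\ affine_hyperplane H, S `&` H !=set0 & connected (S `\` H)].

Definition face S F : Prop :=
  [/\ F !=set0, convex_set F, F `<=` S &
      forall (x y : 'rV[R]_n) (l : R), S x -> S y -> 0 < l < 1 ->
        F (l *: x + (1 - l) *: y) -> F x /\ F y].

Definition exposed S F : Prop :=
  F = S \/ exists2 H, supporting_hyperplane S H & H `&` S = F.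

End Faces.

(* Main.v *)
(* Let [a] be a point of the face [F] at which the fewest constraints vanish.
   The exposing functional is the sum of the differentials at [a] of the [p_i]
   with [p_i(a) = 0]. It is nonnegative on [S] by convexity, and it vanishes on
   [F] because by minimality these [p_i] vanish along segments of [F] starting
   at [a]. If it vanished at some [b] in [S \ F], every such [p_i] would be flat
   at [a] along the line through [a] and [b]; then the evaluation at the point
   [a - h (b - a)], corrected by [O(h^2)] times evaluations on the segment
   [a, b], would be nonnegative on the truncated quadratic module. By exactness
   [S] would contain points of the line beyond [a], forcing [b] into [F]. *)
Require Import Defs.
From HB Require Import structures.
From mathcomp Require Import all_boot all_order all_algebra.
From mathcomp Require Import mpoly.
From mathcomp Require Import interval_inference boolp classical_sets reals.
From mathcomp Require Import topology normedtype convex.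
From mathcomp Require Import ring lra.
Import Order.TTheory GRing.Theory Num.Theory.
Import numFieldNormedType.Exports.

Set Implicit Arguments.
Unset Strict Implicit.
Unset Printing Implicit Defensive.

Local Open Scope classical_set_scope.
Local Open Scope ring_scope.

(** * Real polynomials in one variable: signs near 0 and interpolation *)

Section UnivariatePolynomials.
Context (R : realType).
Implicit Types (p g s : {poly R}) (h t : R).

Lemma poly_split0 p : exists r : {poly R}, p = (p`_0)%:P + 'X * r.
Proof.
exists (drop_poly 1 p); rewrite -[LHS](poly_take_drop 1) expr1 mulrC.
congr (_ + _); apply/polyP => i; rewrite coef_take_poly coefC.
by case: i.
Qed.

Lemma horner_gt0_near p : 0 < p`_0 -> \forall t \near (0 : R), 0 < p.[t].
Proof.
have [r pE] := poly_split0 p; move=> p0.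
have [K rK] := poly_disk_bound r 1.
have K0 : 0 <= K by apply: le_trans (rK 0 _) => //; rewrite normr0.
(* This radius gives |t| (K + 1) < p(0); the + 1 keeps the denominator positive. *)
exists (Num.min 1 (p`_0 / (K + 1))) => /=.
  by rewrite lt_min ltr01 divr_gt0// ltr_wpDl.
move=> t /=; rewrite sub0r normrN lt_min => /andP[t1].
rewrite ltr_pdivlMr ?ltr_wpDl// => tK.
rewrite pE !hornerE.
have : `|t * r.[t]| <= `|t| * K by rewrite normrM ler_wpM2l// rK// ltW.
rewrite ler_norml => /andP[h1 _].
have := normr_ge0 t; lra.
Qed.

Lemma horner_neq0_near p :
  p != 0 -> \forall t \near (0 : R), t != 0 -> p.[t] != 0.
Proof.
move=> p0; have [k [q]] := multiplicity_XsubC p 0.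
rewrite p0 /= rootE subr0 => q0 ->.
(* Scaling by q(0) makes the constant coefficient q(0)^2 > 0, whatever the sign of q(0). *)
have : 0 < (q.[0] *: q)`_0 by rewrite coefZ -horner_coef0 -expr2 exprn_even_gt0.
move=> /horner_gt0_near; apply: filterS => t + t0.
rewrite !hornerE => qt; rewrite mulf_neq0 ?expf_neq0//.
by apply: contraTneq qt => ->; rewrite mulr0 ltxx.
Qed.


Lemma near0_right (P : R -> Prop) :
  (\forall t \near (0 : R), P t) -> \forall t \near (0 : R)^'+, P t.
Proof. by move=> nP; apply: (@cvg_within _ (nbhs (0 : R))). Qed.

Lemma near0_rightN (P : R -> Prop) :
  (\forall t \near (0 : R), P t) -> \forall t \near (0 : R)^'+, P (- t).
Proof.
move=> nP; apply: near0_right.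
have : -%R @ (0 : R) --> (0 : R) by rewrite -[X in _ --> X]oppr0; exact: oppr_continuous.
exact.
Qed.

(** Otherwise p = X r with r(0) < 0, and p is negative just to the right of 0. *)
Lemma coef1_ge0 p : (forall t, 0 <= t <= 1 -> 0 <= p.[t]) -> p`_0 = 0 ->
  0 <= p`_1.
Proof.
move=> p_ge0 p00; rewrite leNgt; apply/negP => p1.
have [r pE] := poly_split0 p; rewrite p00 add0r in pE.
have r0 : 0 < (- r)`_0 by move: p1; rewrite pE coefXM coefN oppr_gt0.
near (0 : R)^'+ => t.
have t0 : 0 < t by near: t; exact: nbhs_right_gt.
have t1 : t < 1 by near: t; exact: nbhs_right_lt.
have : 0 < (- r).[t] by near: t; exact/near0_right/horner_gt0_near.
have := p_ge0 t; rewrite pE !hornerE (ltW t0) (ltW t1) => /(_ isT).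
rewrite pmulr_rge0//; lra.
Unshelve. all: by end_near.
Qed.

(** The interpolation error has degree at most d and d + 1 distinct roots. *)
Lemma horner_interpolation (d : nat) (x : nat -> R) s t :
  injective x -> (size s <= d.+1)%N ->
  s.[t] = \sum_(k < d.+1) s.[x k] * (tnth (lagrange d.+1 x) k : {poly R}).[t].
Proof.
move=> x_inj s_d.
suff -> : s.[t] =
  (\sum_(k < d.+1) s.[x k] *: (tnth (lagrange d.+1 x) k : {poly R})).[t].
  by rewrite horner_sum; under eq_bigr do rewrite hornerZ.
congr (_.[t]); apply/eqP; rewrite -subr_eq0; apply/negPn/negP => e0.
set e := _ - _ in e0.
have e_d : (size e <= d.+1)%N.
  rewrite (leq_trans (size_polyD _ _))// geq_max s_d size_polyN.
  rewrite (leq_trans (size_sum _ _ _))//; apply/bigmax_leqP => k _.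
  by rewrite (leq_trans (size_scale_leq _ _))// size_lagrange_.
suff : (size [seq x k | k <- iota 0 d.+1] < size e)%N.
  by rewrite size_map size_iota ltnNge e_d.
apply: max_poly_roots e0 _ _; last by rewrite map_inj_uniq// iota_uniq.
apply/allP => y /mapP[k]; rewrite mem_iota add0n leq0n /= => kd ->.
rewrite rootE !hornerE horner_sum (bigD1 (Ordinal kd))//= hornerZ.
rewrite (lagrange_sample _ _ _ (Ordinal kd))// eqxx mulr1.
rewrite big1 ?addr0 ?subrr// => j jk.
by rewrite hornerZ (lagrange_sample _ _ _ (Ordinal kd))// (negPf jk) mulr0.
Qed.

(** The Lagrange polynomials are bounded on [-1, 1], so [C] depends only on [d] and the nodes, not
    on [s] or [h]. *)
Lemma extrapolation_bound (d : nat) (x : nat -> R) : injective x ->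
  exists2 C : R, 0 <= C & forall s h, (size s <= d.+1)%N ->
    (forall k : 'I_d.+1, 0 <= s.[x k]) -> 0 <= h <= 1 ->
    s.[- h] <= C * \sum_(k < d.+1) s.[x k].
Proof.
move=> x_inj.
have /choice[C lC] (k : 'I_d.+1) : exists C : R, forall t, `|t| <= 1 ->
    `|(tnth (lagrange d.+1 x) k : {poly R}).[t]| <= C.
  by have [C lC] := poly_disk_bound (tnth (lagrange d.+1 x) k : {poly R}) 1; exists C.
have C0 k : 0 <= C k by apply: le_trans (lC k 0 _); rewrite ?normr0.
exists (\sum_k C k) => [|s h s_d s_ge0 /andP[h0 h1]]; first exact: sumr_ge0.
rewrite (horner_interpolation _ x_inj s_d) mulr_sumr; apply: ler_sum => k _.
rewrite mulrC ler_wpM2r//.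
apply: le_trans (ler_norm _) _; apply: le_trans (lC k _ _) _.
  by rewrite normrN ger0_norm.
by rewrite (bigD1 k)//= lerDl sumr_ge0.
Qed.

End UnivariatePolynomials.

(** * Controlling values at - h by values at nodes in (0, 1] *)

Section Extrapolation.
Context (R : realType).
Implicit Types (s : {poly R}) (h t : R).

(** Finitely many nonzero polynomials have no zeros on some interval (0, e), so the points c / (k +
    1) with c < e serve all of them. *)
Lemma common_sample_points (I : finType) (g : I -> {poly R}) :
  exists x : nat -> R, [/\ injective x, forall k, 0 < x k <= 1 &
    forall i k, g i != 0 -> (g i).[x k] != 0].
Proof.
have g_neq0 : \forall t \near (0 : R)^'+, forall i, g i != 0 -> (g i).[t] != 0.
  apply: filter_forall => i; have [->|gi0] := eqVneq (g i) 0; first exact: nearW.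
  near=> t => _; have : t != 0 by rewrite gt_eqF.
  by near: t; exact/near0_right/horner_neq0_near.
have [e /= e0 eP] := g_neq0.
pose c := Num.min 1 (e / 2).
have c0 : 0 < c by rewrite lt_min ltr01 divr_gt0.
have x0 k : 0 < c / k.+1%:R by rewrite divr_gt0// ltr0n.
have xc k : c / k.+1%:R <= c.
  by rewrite ler_pdivrMr ?ltr0n// ler_peMr ?(ltW c0)// ler1n.
exists (fun k => c / k.+1%:R); split.
- move=> j k /(mulfI (lt0r_neq0 c0))/invr_inj/eqP.
  by rewrite eqr_nat => /eqP[].
- move=> k; rewrite x0 (le_trans (xc k))//.
  by rewrite ge_min lexx.
- move=> i k; apply: eP; last exact: x0.
  rewrite /= sub0r normrN gtr0_norm//.
  apply: le_lt_trans (xc k) _; rewrite gt_min.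
  by apply/orP; right; rewrite ltr_pdivrMr// ltr_pMr// ltr1n.
Unshelve. all: by end_near.
Qed.

(* The exterior sample point [- h] costs only O(h^2): if [g] vanishes at 0 it
   does so to second order, so that [g.[- h]] is at least [- K * h ^+ 2]. *)
Lemma exterior_evaluation (d : nat) (x : nat -> R) (g : {poly R}) :
  injective x -> (forall k : 'I_d.+1, 0 <= g.[x k]) ->
  (g != 0 -> forall k : 'I_d.+1, g.[x k] != 0) ->
  0 <= g`_0 -> (g`_0 = 0 -> g`_1 = 0) ->
  exists2 D : R, 0 <= D & \forall h \near (0 : R)^'+,
    forall s, (forall t, 0 <= s.[t]) -> (size (s * g)%R <= d.+1)%N ->
    0 <= (s * g).[- h] + D * h ^+ 2 * \sum_(k < d.+1) (s * g).[x k].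
Proof.
move=> x_inj g_ge0 g_neq0 g00 g01.
have [->|gN0] := eqVneq g 0.
  exists 0 => //; apply: nearW => h s _ _.
  by rewrite !mul0r mulr0 horner0 addr0.
have [g00E|] := eqVneq g`_0 0; last first.
  move=> g0_neq0; exists 0 => //.
  have /horner_gt0_near/near0_rightN : 0 < g`_0 by rewrite lt_neqAle eq_sym g0_neq0.
  apply: filterS => h gh s s_ge0 _.
  by rewrite !mul0r addr0 hornerM mulr_ge0// ltW.
have [r1 gE] := poly_split0 g; rewrite g00E add0r in gE.
have [r r1E] := poly_split0 r1.
have r10 : r1`_0 = 0 by have := g01 g00E; rewrite gE coefXM.
(* Both low coefficients vanish, so g = X^2 r. *)
rewrite r10 add0r in r1E; rewrite r1E in gE.
have [K rK] := poly_disk_bound r 1.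
have K0 : 0 <= K by apply: le_trans (rK 0 _); rewrite ?normr0.
have [C C0 sC] := extrapolation_bound d x_inj.
(* At each node 1 <= B g(x_k), hence s(x_k) <= B (s g)(x_k). *)
pose B := \sum_(k < d.+1) (g.[x k])^-1.
have B0 : 0 <= B by apply: sumr_ge0 => k _; rewrite invr_ge0.
exists (K * C * B); first by rewrite !mulr_ge0.
near=> h => s s_ge0 sgd.
have h0 : 0 < h by [].
have h1 : h < 1 by near: h; exact: nbhs_right_lt.
have [->|sN0] := eqVneq s 0.
  rewrite mul0r horner0 add0r mulr_ge0 ?mulr_ge0 ?sqr_ge0//.
  by apply: sumr_ge0 => k _; rewrite horner0.
(* Degrees add for nonzero factors, so the degree bound passes from s g to s. *)
have sd : (size s <= d.+1)%N.
  apply: leq_trans sgd; rewrite size_mul// -subn1 -addnBA ?leq_addr//.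
  by rewrite size_poly_gt0.
have sum_s : \sum_(k < d.+1) s.[x k] <= B * \sum_(k < d.+1) (s * g).[x k].
  rewrite mulr_sumr; apply: ler_sum => k _; rewrite hornerM mulrCA.
  rewrite ler_peMr//.
  rewrite -[leLHS](mulVf (g_neq0 gN0 k)) ler_wpM2r//.
  by rewrite /B (bigD1 k)//= lerDl sumr_ge0// => j _; rewrite invr_ge0.
have s_h := sC s h sd (fun k => s_ge0 _).
have {}s_h : s.[- h] <= C * (B * \sum_(k < d.+1) (s * g).[x k]).
  apply: le_trans (s_h _) _; first by rewrite !ltW.
  by rewrite ler_wpM2l.
have g_h : - (K * h ^+ 2) <= g.[- h].
  have -> : g.[- h] = h ^+ 2 * r.[- h].
    by rewrite gE !hornerM hornerX mulrA mulrNN -expr2.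
  rewrite mulrC -mulrN ler_wpM2l ?sqr_ge0//.
  have : `|r.[- h]| <= K by rewrite rK// normrN gtr0_norm// ltW.
  by rewrite ler_norml => /andP[].
rewrite [(s * g).[- h]]hornerM.
have : - (K * h ^+ 2) * (C * (B * \sum_(k < d.+1) (s * g).[x k])) <=
    s.[- h] * g.[- h].
  apply: (@le_trans _ _ (s.[- h] * - (K * h ^+ 2))); last by rewrite ler_wpM2l.
  have Kh : 0 <= K * h ^+ 2 by rewrite mulr_ge0// sqr_ge0.
  by rewrite mulrC !mulrN lerN2 ler_wpM2r.
lra.
Unshelve. all: by end_near.
Qed.

(** Nodes and [D] are common to the family, so that one functional can serve all generators of the
    quadratic module. The individual constants may be summed because the node sums are
    nonnegative. *)
Lemma exterior_quadrature (I : finType) (g : I -> {poly R}) (d : nat) :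
  (forall i t, 0 <= t <= 1 -> 0 <= (g i).[t]) ->
  (forall i, (g i)`_0 = 0 -> (g i)`_1 = 0) ->
  exists x : nat -> R, (forall k, 0 < x k <= 1) /\
  exists2 D : R, 0 <= D & \forall h \near (0 : R)^'+,
    forall i s, (forall t, 0 <= s.[t]) -> (size (s * g i)%R <= d.+1)%N ->
    0 <= (s * g i).[- h] + D * h ^+ 2 * \sum_(k < d.+1) (s * g i).[x k].
Proof.
move=> g_ge0 g01; have [x [x_inj x01 xN0]] := common_sample_points g.
exists x; split=> //.
have g_x i k : 0 <= (g i).[x k].
  by apply: g_ge0; have /andP[/ltW -> ->] := x01 k.
have g0 i : 0 <= (g i)`_0 by rewrite -horner_coef0 g_ge0// lexx ler01.
have /choice[D DP] (i : I) : exists D : R, 0 <= D /\ \forall h \near (0 : R)^'+,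
    forall s, (forall t, 0 <= s.[t]) -> (size (s * g i)%R <= d.+1)%N ->
    0 <= (s * g i).[- h] + D * h ^+ 2 * \sum_(k < d.+1) (s * g i).[x k].
  have [D D0 DP] := exterior_evaluation x_inj (fun k : 'I_d.+1 => g_x i k)
    (fun gN0 k => xN0 i k gN0) (g0 i) (g01 i).
  by exists D.
have D0 i : 0 <= D i by have [] := DP i.
exists (\sum_i D i); first exact: sumr_ge0.
apply: filter_forall => i; have [_] := DP i; apply: filterS => h hP s s0 sd.
apply: le_trans (hP s s0 sd) _; rewrite lerD2l ler_wpM2r//.
  by apply: sumr_ge0 => k _; rewrite hornerM mulr_ge0.
rewrite ler_wpM2r ?sqr_ge0// (bigD1 i)//= lerDl sumr_ge0//.
Qed.

End Extrapolation.

(** * Restriction of polynomials to a line *)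

Section LineRestriction.
Context (R : realType) (n : nat).
Implicit Types (a u : 'rV[R]_n) (q : {mpoly R[n]}) (t : R).

Definition line_coord a u (j : 'I_n) : {poly R} :=
  (a ord0 j)%:P + u ord0 j *: 'X.

(** The polynomial q(a + t u) in t; its coefficient of index 1 is the derivative of q at [a] along
    [u]. *)
Definition line_restr a u q : {poly R} := mmap polyC (line_coord a u) q.

Lemma horner_line_restr a u q t :
  (line_restr a u q).[t] = q.@[fun j => (a + t *: u) ord0 j].
Proof.
rewrite /line_restr /mmap mevalE horner_sum; apply: eq_bigr => k _.
rewrite hornerM hornerC /mmap1 horner_prod; congr (_ * _).
by apply: eq_bigr => j _; rewrite horner_exp !hornerE !mxE mulrC.
Qed.

Lemma size_line_restr a u q d :
  q \is a polydeg d -> (size (line_restr a u q) <= d.+1)%N.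
Proof.
rewrite qualifE /= => qd; apply: leq_trans qd.
apply: leq_trans (size_sum _ _ _) _; apply/bigmax_leqP_seq => k kq _.
rewrite mul_polyC; apply: leq_trans (size_scale_leq _ _) _.
apply: leq_trans (msize_mdeg_lt kq); rewrite /mmap1 mdegE.
elim/big_rec2: _ => [|j P e _ IH]; first by rewrite size_poly1.
have c_j : (size (line_coord a u j) <= 2)%N.
  rewrite (leq_trans (size_polyD _ _))// geq_max.
  rewrite (leq_trans (size_polyC_leq1 _))//=.
  by rewrite (leq_trans (size_scale_leq _ _))// size_polyX.
have c_jk : (size (line_coord a u j ^+ k j) <= (k j).+1)%N.
  apply: leq_trans (size_poly_exp_leq _ _) _; rewrite ltnS.
  by rewrite -[leqRHS]mul1n leq_mul2r -subn1 leq_subLR c_j orbT.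
apply: leq_trans (size_polyMleq _ _) _.
rewrite -subn1 leq_subLR add1n (leq_trans (leq_add c_jk IH))//.
by rewrite addSn addnS.
Qed.

Lemma coef0_line_restr a u q : (line_restr a u q)`_0 = q.@[fun j => a ord0 j].
Proof.
rewrite -horner_coef0 horner_line_restr.
by apply: meval_eq => j; rewrite scale0r addr0.
Qed.

(** The vector [w] is the gradient of q at [a]. Induction on q; the product case is the Leibniz
    rule. *)
Lemma line_restr_gradient a q : exists w : 'rV[R]_n, forall u,
  (line_restr a u q)`_1 = \sum_(j < n) w ord0 j * u ord0 j.
Proof.
pose P q := exists w : 'rV[R]_n, forall u,
  (line_restr a u q)`_1 = \sum_(j < n) w ord0 j * u ord0 j.
have PC c : P c%:MP.
  exists 0 => u; rewrite /line_restr mmapC coefC /=; apply/esym/big1 => j _.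
  by rewrite mxE mul0r.
have PX i : P 'X_i.
  exists (delta_mx ord0 i) => u; rewrite /line_restr mmapX mmap1U.
  rewrite coefD coefC coefZ coefX mulr1 add0r (bigD1 i)//= big1 => [|j ji].
    by rewrite mxE !eqxx mul1r addr0.
  by rewrite mxE (negPf ji) mul0r.
have PD q1 q2 : P q1 -> P q2 -> P (q1 + q2).
  move=> [w1 Pq1] [w2 Pq2]; exists (w1 + w2) => u.
  rewrite /line_restr rmorphD coefD Pq1 Pq2 -big_split /=.
  by apply: eq_bigr => j _; rewrite mxE mulrDl.
have PM q1 q2 : P q1 -> P q2 -> P (q1 * q2).
  move=> [w1 Pq1] [w2 Pq2].
  exists (q1.@[fun j => a ord0 j] *: w2 + q2.@[fun j => a ord0 j] *: w1) => u.
  rewrite /line_restr rmorphM coefM big_ord_recl big_ord1 /=.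
  rewrite -!/(line_restr _ _ _) Pq1 Pq2 !coef0_line_restr mulr_sumr mulr_suml.
  by rewrite -big_split /=; apply: eq_bigr => j _; rewrite !mxE; ring.
have P1 : P 1 by rewrite -mpolyC1; exact: PC.
elim/mpolyind: q => [|c k q _ _ Pq]; first by rewrite -mpolyC0; exact: PC.
apply: (PD _ _ _ Pq); rewrite -mul_mpolyC mpolyXE_id; apply: (PM _ _ (PC c)).
elim/big_ind: _ => // i _.
by elim: (k i) => [|e IH]; rewrite ?expr0// exprS; apply: PM.
Qed.

End LineRestriction.

(** * Weighted sums of point evaluations as Lasserre functionals *)

Section PointEvaluations.
Context (R : realType) (n d : nat) (ws : seq (R * 'rV[R]_n)).

Definition evaluation_sum (f : mpolyd n R d) : R :=
  \sum_(e <- ws) e.1 * (f : {mpoly R[n]}).@[fun j => e.2 ord0 j].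

Fact evaluation_sum_is_scalar : scalar evaluation_sum.
Proof.
move=> c f g; rewrite /evaluation_sum mulr_sumr -big_split /=.
by apply: eq_bigr => e _; rewrite mevalD mevalZ; ring.
Qed.

HB.instance Definition _ :=
  GRing.isLinear.Build R (mpolyd n R d) R *%R evaluation_sum
    evaluation_sum_is_scalar.

(** The functional sends each variable to the weighted sum of that coordinate; [1 <= d] keeps
    [inmpolyd] from its default value 0 at the variables. *)
Lemma evaluation_sum_relaxation m (p : m.-tuple {mpoly R[n]}) : (1 <= d)%N ->
  \sum_(e <- ws) e.1 = 1 ->
  (forall f, quadratic_module p d f -> 0 <= evaluation_sum f) ->
  lasserre_relaxation p d (\sum_(e <- ws) e.1 *: e.2).
Proof.
move=> d1 w1 QM0; exists evaluation_sum.
  split=> //=; rewrite /evaluation_sum inmpolydK ?polydeg1// -[RHS]w1.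
  by apply: eq_bigr => e _; rewrite meval1 mulr1.
apply/rowP => j; rewrite mxE /= /evaluation_sum inmpolydK ?polydegX//.
rewrite summxE; apply: eq_bigr => e _.
by rewrite mevalXU mxE.
Qed.

End PointEvaluations.

(** * Segments and connectedness *)

Section ConvexSets.
Context (R : realType) (n : nat).
Implicit Types (S : set 'rV[R]_n) (x y : 'rV[R]_n).

Lemma convex_set_segment S x y (t : R) : convex_set S -> S x -> S y ->
  0 <= t <= 1 -> S (x + t *: (y - x)).
Proof.
move=> cS Sx Sy /andP[t0 t1].
have := cS y x (Itv01 t0 t1); rewrite !inE => /(_ Sy Sx).
suff -> : x + t *: (y - x) = t *: y + (1 - t) *: x by [].
by rewrite scalerBl scale1r scalerBr addrCA.
Qed.

(** The set is a union of segments, each connected, that share one endpoint. *)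
Lemma segment_closed_connected S :
  (forall x y (t : R), S x -> S y -> 0 <= t <= 1 -> S (x + t *: (y - x))) ->
  connected S.
Proof.
move=> cS; have [->|/set0P[x Sx]] := eqVneq S set0; first exact: connected0.
pose seg y : set 'rV[R]_n := (fun t : R => x + t *: (y - x)) @` `[0, 1].
have -> : S = \bigcup_(y in S) seg y.
  apply/seteqP; split=> [y Sy|z [y Sy [t]]] /=.
    exists y => //; exists 1; first by rewrite /= in_itv /= ler01 lexx.
    by rewrite scale1r addrC subrK.
  by rewrite in_itv /= => t01 <-; exact: cS.
apply: bigcup_connected.
  exists x => y Sy; exists 0; first by rewrite /= in_itv /= ler01 lexx.
  by rewrite scale0r addr0.
move=> y Sy; rewrite /seg.
have cf : continuous (fun t : R => x + t *: (y - x)).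
  by move=> t; apply: cvgD; [exact: cvg_cst|apply: cvgZr_tmp; exact: cvg_id].
exact: (connected_continuous_connected (@segment_connected R 0 1)
  (continuous_subspaceT cf)).
Qed.

End ConvexSets.

(** * What exactness says about segments that cannot be prolonged *)

Section ExactRelaxation.
Context (R : realType) (n m d : nat) (p : m.-tuple {mpoly R[n]}).
Context (hconv : convex_set (basic_closed p)) (d1 : (1 <= d)%N)
  (hexact : lasserre_relaxation p d = basic_closed p).
Implicit Types (a b : 'rV[R]_n).

Lemma line_restr_ge0 a b i t : basic_closed p a -> basic_closed p b ->
  0 <= t <= 1 -> 0 <= (line_restr a (b - a) (tnth p i)).[t].
Proof.
move=> Sa Sb t01; rewrite horner_line_restr.
exact: (convex_set_segment hconv Sa Sb t01 i).
Qed.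

Lemma sum_of_squares_line_restr_ge0 a u s t :
  sum_of_squares s -> 0 <= (line_restr a u s).[t].
Proof.
move=> [qs ->]; rewrite horner_line_restr raddf_sum /=.
by apply: sumr_ge0 => q _; rewrite rmorphXn /= sqr_ge0.
Qed.

(* Otherwise a normalized sum of the evaluation at [a - h u], where [u = b - a],
   and of evaluations with weights [D h^2] at points of the segment is a
   Lasserre functional; its point lies strictly beyond [a], since [h]
   outweighs [h^2]. *)
Lemma nonextendable_segment_active a b :
  basic_closed p a -> basic_closed p b ->
  (forall e : R, 0 < e -> ~ basic_closed p (a - e *: (b - a))) ->
  exists i, (tnth p i).@[fun j => a ord0 j] = 0 /\
    (line_restr a (b - a) (tnth p i))`_1 != 0.
Proof.
move=> Sa Sb nS; apply: contrapT => /forallNP flat.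
set u := b - a in nS flat *.
(* Index 0 carries p_0 = 1, whose restriction is the constant 1 and so meets the flatness condition
   vacuously. *)
pose q (i : 'I_m.+1) : {mpoly R[n]} := tnth [tuple of 1 :: p] i.
pose g i := line_restr a u (q i).
have g_ge0 i t : 0 <= t <= 1 -> 0 <= (g i).[t].
  rewrite /g /q; case: (unliftP ord0 i) => [j|] -> t01.
    by rewrite tnthS; exact: line_restr_ge0.
  by rewrite tnth0 /line_restr rmorph1 hornerC ler01.
have g_flat i : (g i)`_0 = 0 -> (g i)`_1 = 0.
  rewrite /g /q; case: (unliftP ord0 i) => [j|] ->.
    rewrite tnthS coef0_line_restr => pa; apply/eqP/negPn/negP => g1.
    by apply: (flat j); split.
  by rewrite tnth0 /line_restr rmorph1 !coefC.
have [x [x01 [D D0 quad]]] := exterior_quadrature d g_ge0 g_flat.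
near (0 : R)^'+ => h.
have h0 : 0 < h by [].
(* Obtained from h < 1 / (D (d + 1) + 1), where the + 1 covers D = 0. *)
have hD : D * d.+1%:R * h < 1.
  apply: (@le_lt_trans _ _ ((D * d.+1%:R + 1) * h)).
    by rewrite ler_wpM2r ?(ltW h0)// lerDl.
  rewrite mulrC -ltr_pdivlMr ?div1r; last by rewrite ltr_wpDl ?mulr_ge0.
  near: h; apply: nbhs_right_lt.
  by rewrite invr_gt0 ltr_wpDl ?mulr_ge0.
have quad_h : forall i s, (forall t, 0 <= s.[t]) ->
    (size (s * g i)%R <= d.+1)%N ->
    0 <= (s * g i).[- h] + D * h ^+ 2 * \sum_(k < d.+1) (s * g i).[x k].
  by near: h; exact: quad.
(* Each node gets mass c and the exterior point mass 1; dividing by the total [N] normalizes L(1) =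
   1. *)
pose c := D * h ^+ 2; pose N := 1 + c * d.+1%:R.
have c0 : 0 <= c by rewrite mulr_ge0// sqr_ge0.
have N0 : 0 < N by rewrite ltr_wpDr// mulr_ge0.
(* The shape in which [field] asks for N to be nonzero. *)
have N_neq0 : 1 + c * (1 + d%:R) != 0.
  by rewrite [1 + _%:R]addrC natr1 gt_eqF.
pose ws := (N^-1, a + (- h) *: u) ::
  [seq (c / N, a + x k *: u) | k : 'I_d.+1 <- index_enum 'I_d.+1].
(* The nodes push the barycentre towards b by less than the exterior point pushes it away, as x_k <=
   1. *)
have sumx : c * \sum_(k < d.+1) x k < h.
  apply: (@le_lt_trans _ _ (c * d.+1%:R)).
    rewrite ler_wpM2l// -[d.+1 in leRHS]card_ord -sumr_const.
    by apply: ler_sum => k _; have /andP[] := x01 k.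
  have -> : c * d.+1%:R = D * d.+1%:R * h * h by rewrite /c; ring.
  by rewrite gtr_pMl.
have ws_point : \sum_(e <- ws) e.1 *: e.2 =
    a - ((h - c * \sum_(k < d.+1) x k) / N) *: u.
  rewrite /ws big_cons big_map /=.
  under eq_bigr => k _ do rewrite scalerDr scalerA.
  rewrite big_split /= sumr_const card_ord -scaler_suml -mulr_sumr.
  apply/rowP => j; rewrite !mxE mulmxnE !mxE -mulr_natr.
  by rewrite /N; field; exact: N_neq0.
apply: nS (_ : 0 < (h - c * \sum_(k < d.+1) x k) / N) _.
  by rewrite divr_gt0// subr_gt0.
rewrite -hexact -ws_point; apply: evaluation_sum_relaxation => //.
  rewrite /ws big_cons big_map /= sumr_const card_ord -mulr_natr /N.
  by field; exact: N_neq0.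
move=> f [sigma [sos_sigma sigma_d fE]].
pose s i := line_restr a u (sigma i).
(* Linearity splits the value at f into one term per sigma_i p_i, each of the form bounded by
   [quad_h]. *)
have -> : evaluation_sum ws f = N^-1 * \sum_(i < m.+1)
   ((s i * g i).[- h] + c * \sum_(k < d.+1) (s i * g i).[x k]).
  rewrite big_split /= -mulr_sumr exchange_big /= -horner_sum.
  under eq_bigr => k _ do rewrite -horner_sum.
  have -> : \sum_(i < m.+1) s i * g i = line_restr a u f.
    rewrite fE /line_restr rmorph_sum /=; apply: eq_bigr => i _.
    by rewrite rmorphM.
  rewrite /evaluation_sum /ws big_cons big_map /=.
  rewrite mulrDr mulrA horner_line_restr; congr (_ + _); rewrite mulr_sumr.
  by apply: eq_bigr => k _; rewrite horner_line_restr [c / N]mulrC.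
rewrite mulr_ge0 ?invr_ge0 ?(ltW N0)//; apply: sumr_ge0 => i _.
apply: quad_h => [t|]; first exact: sum_of_squares_line_restr_ge0.
have -> : s i * g i = line_restr a u (sigma i * q i).
  by rewrite /line_restr rmorphM.
exact/size_line_restr/sigma_d.
Unshelve. all: by end_near.
Qed.

End ExactRelaxation.

(** * Active constraints on a face *)

Section ActiveConstraints.
Context (R : realType) (n m : nat) (p : m.-tuple {mpoly R[n]}).
Implicit Types (a y : 'rV[R]_n) (F S : set 'rV[R]_n).

Definition active_constraints a : {set 'I_m} :=
  [set i | (tnth p i).@[fun j => a ord0 j] == 0].

(** A set of natural numbers has a least element; the point found stands in for a relative interior
    point of F. *)
Lemma few_active_constraints F : F !=set0 -> exists2 a, F a &
  forall y, F y -> (#|active_constraints a| <= #|active_constraints y|)%N.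
Proof.
move=> [y Fy].
pose P k := `[< exists2 a, F a & #|active_constraints a| = k >].
have exP : exists k, P k.
  by exists #|active_constraints y|; apply/asboolP; exists y.
case: (ex_minnP exP) => k /asboolP[a Fa <-] k_min; exists a => // z Fz.
by apply: k_min; apply/asboolP; exists z.
Qed.

(* Moving from [a] slightly towards [y] cannot activate a constraint, so by
   minimality it cannot deactivate one either. *)
Lemma minimal_active_flat F a y i : convex_set F -> F `<=` basic_closed p ->
  F a ->
  (forall z, F z -> (#|active_constraints a| <= #|active_constraints z|)%N) ->
  F y -> i \in active_constraints a -> line_restr a (y - a) (tnth p i) = 0.
Proof.
move=> cF FS Fa a_min Fy ai; apply/eqP/negPn/negP => gi.
near (0 : R)^'+ => t.
have t0 : 0 < t by [].
have t1 : t < 1 by near: t; exact: nbhs_right_lt.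
have t01 : 0 <= t <= 1 by rewrite !ltW.
have : (line_restr a (y - a) (tnth p i)).[t] != 0.
  have : t != 0 by rewrite gt_eqF.
  by near: t; exact/near0_right/horner_neq0_near.
have inactive : forall k, 0 < (line_restr a (y - a) (tnth p k))`_0 ->
    0 < (line_restr a (y - a) (tnth p k)).[t].
  near: t; apply: filter_forall => k.
  have [k0|_] := ltP 0 (line_restr a (y - a) (tnth p k))`_0; last exact: nearW.
  by near=> t => _; near: t; exact/near0_right/horner_gt0_near.
have sub : active_constraints (a + t *: (y - a)) \subset active_constraints a.
  apply/fintype.subsetP => k; rewrite !inE -horner_line_restr; apply: contraLR => ak.
  rewrite gt_eqF// inactive// coef0_line_restr lt_neqAle eq_sym ak.
  exact: FS Fa k.
have Ft := convex_set_segment cF Fa Fy t01.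
(* Inclusion and minimality force equality, so p_i vanishes at the new point, against the choice of
   t. *)
have /eqP act_eq : active_constraints (a + t *: (y - a)) == active_constraints a.
  by rewrite eqEcard sub a_min.
by move: ai; rewrite -act_eq inE -horner_line_restr => ->.
Unshelve. all: by end_near.
Qed.

(** Otherwise [a] lies strictly between [y] and the prolonged point, with weight e / (1 + e) on [y],
    and the face property puts [y] in F. *)
Lemma face_nonextendable S F a y (e : R) : face S F -> F a -> S y -> ~ F y ->
  0 < e -> ~ S (a - e *: (y - a)).
Proof.
move=> [_ _ _ faceF] Fa Sy nFy e0 Sz; apply: nFy.
have e1 : 0 < 1 + e by rewrite addr_gt0.
suff aE : a = (e / (1 + e)) *: y + (1 - e / (1 + e)) *: (a - e *: (y - a)).
  have [] // := faceF _ _ (e / (1 + e)) Sy Sz; last by rewrite -aE.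
  by rewrite divr_gt0//= ltr_pdivrMr// mul1r ltrDr.
by apply/rowP => j; rewrite !mxE; field; rewrite gt_eqF.
Qed.

End ActiveConstraints.

(** * The exposing hyperplane of a proper face *)

Theorem theorem3p5 (R : realType) (n m : nat) (p : m.-tuple {mpoly R[n]})
  (hconv : convex_set (basic_closed p))
  (hint : (basic_closed p)° !=set0)
  (hexact : exists2 d : nat, (1 <= d)%N &
              lasserre_relaxation p d = basic_closed p) :
  forall F : set 'rV[R]_n,
    face (basic_closed p) F -> exposed (basic_closed p) F.
Proof.
move=> F hF; have [F_neq0 cF FS _] := hF; case: hexact => d d1 hd.
set S := basic_closed p in hconv hd hF FS *.
have [->|FneS] := pselect (F = S); [by left|right].
have [b Sb nFb] : exists2 b, S b & ~ F b.
  apply: contrapT => /forall2NP SF; apply: FneS; apply/seteqP; split=> // y Sy.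
  by case: (SF y) => // /contrapT.
have [a Fa a_min] := few_active_constraints p F_neq0.
have Sa := FS _ Fa.
pose active i := i \in active_constraints p a.
have /choice[w wP] i := line_restr_gradient a (tnth p i).
pose v := \sum_(i | active i) w i.
have vE y : \sum_(j < n) v ord0 j * (y - a) ord0 j =
    \sum_(i | active i) (line_restr a (y - a) (tnth p i))`_1.
  under [RHS]eq_bigr => i _ do rewrite wP.
  rewrite exchange_big /=; apply: eq_bigr => j _.
  by rewrite /v summxE mulr_suml.
have deriv_ge0 y i : S y -> active i ->
    0 <= (line_restr a (y - a) (tnth p i))`_1.
  move=> Sy; rewrite /active inE => /eqP ai.
  apply: coef1_ge0 => [t t01|]; last by rewrite coef0_line_restr.
  exact: line_restr_ge0.
(* All the derivatives summed are nonnegative, and one is nonzero because the segment from y cannot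
   be prolonged beyond [a]. *)
have v_gt0 y : S y -> ~ F y -> 0 < \sum_(j < n) v ord0 j * (y - a) ord0 j.
  move=> Sy nFy.
  have [i [ai gi]] := nonextendable_segment_active hconv d1 hd Sa Sy
    (fun e => face_nonextendable hF Fa Sy nFy).
  have {}ai : active i by rewrite /active inE ai.
  rewrite vE (bigD1 i)//= ltr_wpDr//.
    by apply: sumr_ge0 => k /andP[ak _]; exact: deriv_ge0.
  by rewrite lt_neqAle eq_sym gi deriv_ge0.
have v_eq0 y : F y -> \sum_(j < n) v ord0 j * (y - a) ord0 j = 0.
  move=> Fy; rewrite vE; apply: big1 => i ai.
  by rewrite (minimal_active_flat cF FS Fa a_min Fy ai) coef0.
have vB y : \sum_(j < n) v ord0 j * (y - a) ord0 j =
    \sum_(j < n) v ord0 j * y ord0 j - \sum_(j < n) v ord0 j * a ord0 j.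
  by rewrite -sumrB; apply: eq_bigr => j _; rewrite !mxE mulrBr.
pose H : set 'rV[R]_n :=
  [set x | \sum_(j < n) v ord0 j * x ord0 j = \sum_(j < n) v ord0 j * a ord0 j].
have HF y : S y -> H y -> F y.
  move=> Sy Hy; apply: contrapT => /(v_gt0 _ Sy).
  by rewrite vB Hy subrr ltxx.
have FH y : F y -> H y by move=> /v_eq0/eqP; rewrite vB subr_eq0 => /eqP.
exists H; last first.
  apply/seteqP; split=> [y [Hy Sy]|y Fy]; first exact: HF.
  by split; [exact: FH | exact: FS].
split.
- exists v, (\sum_(j < n) v ord0 j * a ord0 j); split=> //.
  apply/eqP => v0; have := v_gt0 b Sb nFb.
  by rewrite v0 big1 ?ltxx// => j _; rewrite mxE mul0r.
- by exists a; split=> //; exact: FH.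
(* A point of S off H is off F, so the functional is positive there; positivity is kept along
   segments, which thus avoid H. *)
- apply: segment_closed_connected => x y t [Sx nHx] [Sy nHy] /andP[t0 t1].
  split; first by apply: convex_set_segment => //; rewrite t0.
  have x0 : 0 < \sum_(j < n) v ord0 j * (x - a) ord0 j.
    by apply: v_gt0 => // /FH.
  have y0 : 0 < \sum_(j < n) v ord0 j * (y - a) ord0 j.
    by apply: v_gt0 => // /FH.
  move/eqP; rewrite -subr_eq0 -vB => /eqP.
  have -> : \sum_(j < n) v ord0 j * (x + t *: (y - x) - a) ord0 j =
      (1 - t) * (\sum_(j < n) v ord0 j * (x - a) ord0 j) +
      t * \sum_(j < n) v ord0 j * (y - a) ord0 j.
    rewrite !mulr_sumr -big_split /=; apply: eq_bigr => j _.
    by rewrite !mxE; ring.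
  nra.
Qed.
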